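(* Let $P$ be a patch of $K$ which is simply connected and chain-connected. Then the only cell-preserving automorphism of $P$ is the identity map.
   Context: $K$ is the decorated combinatorial tiling: a 2-dimensional CW-complex homeomorphic to the open disk, built as follows. A decorated pentagon has boundary vertices $v_1,\dots,v_5$ in cyclic order (indices mod 5) with corner labels $1,\dots,5$, corner $v_i$ labelled $i$. The rule $\omega$ adds a vertex $m_i$ inside each edge $v_iv_{i+1}$, interior vertices $c_1,\dots,c_5$, edges $c_ic_{i+1}$, $c_im_i$, and replaces the face by the central pentagon $c_1\cdots c_5$ (label $i+1$ at $c_i$) and petals $v_i\,m_i\,c_i\,c_{i-1}\,m_{i-1}$ with labels $i,i+1,i+2,i+3,i+4$ (mod 5) at these corners. $K_0$ is one decorated pentagon, $K_n=\omega^n(K_0)$, $K_n$ embeds label-preservingly onto the central superpentagon $\omega^n(\text{central face of }\omega(K_0))$ of $K_{n+1}$, and $K$ is the direct limit. Automorphisms are cell-preserving and preserve corner labels. A patch is a finite subcomplex that is a union of faces (with their edges and vertices); chain-connected means any two faces are joined by a finite chain of its faces, consecutive ones sharing an edge. *)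

(* Defs.v *)
From mathcomp Require Import all_boot all_algebra.
Set Implicit Arguments. Unset Strict Implicit. Unset Printing Implicit Defensive.
Import GRing.Theory.

(* A decorated pentagonal face: the vertex sitting at each corner.
   Corner label index j : 'I_5 stands for the paper's label j+1;
   labels increase along the boundary cycle, so the boundary edges of
   a face f are {f j, f (j+1)} (label arithmetic mod 5). *)
Definition face := {ffun 'I_5 -> nat}.

(* a finite pentagonal complex: number of vertices (ids 0..N-1) and faces *)
Definition cplx := (nat * seq face)%type.

Definition nedge (a b : nat) : nat * nat := (minn a b, maxn a b).

Definition face_edges (f : face) : seq (nat * nat) :=
  [seq nedge (f i) (f (i + 1)%R) | i <- enum 'I_5].

Definition all_edges (fs : seq face) : seq (nat * nat) :=
  undup (flatten [seq face_edges f | f <- fs]).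

(* The subdivision rule omega. Old vertices keep their ids; the midpoint
   m of the edge {a,b} gets a fresh id determined by the (unordered)
   edge, so it is shared by the two faces containing that edge; the
   interior vertices c_i of the k-th face get fresh ids. *)
Section Omega.
Variables (N : nat) (E : seq (nat * nat)).

Definition mid (a b : nat) : nat := N + index (nedge a b) E.
Definition cen (k : nat) (i : 'I_5) : nat := N + size E + 5 * k + i.

Definition central (k : nat) : face := [ffun j => cen k (j - 1)%R].

Definition petal (k : nat) (f : face) (i : 'I_5) : face :=
  [ffun j : 'I_5 =>
     match nat_of_ord (j - i)%R with
     | 0 => f i
     | 1 => mid (f i) (f (i + 1)%R)
     | 2 => cen k i
     | 3 => cen k (i - 1)%R
     | _ => mid (f (i - 1)%R) (f i)
     end].

Definition subdiv (k : nat) (f : face) : seq face :=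
  central k :: [seq petal k f i | i <- enum 'I_5].
End Omega.

Definition omega (K : cplx) : cplx :=
  let: (N, fs) := K in
  let E := all_edges fs in
  (N + size E + 5 * size fs,
   flatten [seq subdiv N E kf.1 kf.2 | kf <- zip (iota 0 (size fs)) fs]).

Definition K0 : cplx := (5, [:: [ffun j : 'I_5 => nat_of_ord j]]).

Definition Kn (n : nat) : cplx := iter n omega K0.
Definition Kfaces (n : nat) : seq face := (Kn n).2.

Definition patch_of (n : nat) (P : seq face) : Prop := all (mem (Kfaces n)) P.

Definition verts (P : seq face) : seq nat :=
  flatten (map (fun f : face => [seq f j | j <- enum 'I_5]) P).

Definition adj (P : seq face) (a b : nat) : Prop :=
  exists2 f, f \in P & exists j : 'I_5,
    (f j = a /\ f (j + 1)%R = b) \/ (f j = b /\ f (j + 1)%R = a).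

Definition share_edge (f g : face) : Prop :=
  exists i j : 'I_5, nedge (f i) (f (i + 1)%R) = nedge (g j) (g (j + 1)%R).

Inductive chain (P : seq face) : face -> face -> Prop :=
| chain_refl f : f \in P -> chain P f f
| chain_step f g h : chain P f g -> h \in P -> share_edge g h -> chain P f h.

Definition chain_connected (P : seq face) : Prop :=
  forall f g, f \in P -> g \in P -> chain P f g.

(* ---------- simple connectivity via the edge-path group of the 2-complex *)

Fixpoint epath (P : seq face) (x : nat) (s : seq nat) : Prop :=
  if s is y :: s' then adj P x y /\ epath P y s' else True.

Inductive hstep (P : seq face) : seq nat -> seq nat -> Prop :=
| hs_back s1 s2 a b : adj P a b ->
    hstep P (s1 ++ [:: a; b; a] ++ s2) (s1 ++ a :: s2)
| hs_face s1 s2 (f : face) (j : 'I_5) : f \in P ->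
    hstep P (s1 ++ f j :: s2)
      (s1 ++ [:: f j; f (j + 1)%R; f (j + 2)%R; f (j + 3)%R; f (j + 4)%R; f j]
          ++ s2).

Inductive htpc (P : seq face) : seq nat -> seq nat -> Prop :=
| ht_refl s : htpc P s s
| ht_step s t : hstep P s t -> htpc P s t
| ht_sym s t : htpc P s t -> htpc P t s
| ht_trans s t u : htpc P s t -> htpc P t u -> htpc P s u.

Definition path_connected (P : seq face) : Prop :=
  forall u v, u \in verts P -> v \in verts P ->
    exists s, epath P u s /\ last u s = v.

Definition simply_connected (P : seq face) : Prop :=
  path_connected P /\
  forall x s, x \in verts P -> epath P x s -> last x s = x ->
    htpc P (x :: s) [:: x].

(* ---------- cell-preserving, corner-label-preserving automorphisms of P:
   a bijection phi of the vertices and a bijection psi of the faces of P such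
   that the corner of psi f with label j is the image of the corner of f
   with label j (edges {f j, f (j+1)} are then sent to the edges
   {psi f j, psi f (j+1)}, the only possible choice). *)
Definition automorphism (P : seq face) (phi : nat -> nat) (psi : face -> face)
  : Prop :=
     {in verts P &, injective phi}
  /\ {in verts P, forall v, phi v \in verts P}
  /\ {in verts P, forall w, exists2 v, v \in verts P & phi v = w}
  /\ {in P &, injective psi}
  /\ {in P, forall f, psi f \in P}
  /\ {in P, forall g, exists2 f, f \in P & psi f = g}
  /\ {in P, forall f (j : 'I_5), psi f j = phi (f j)}.

(* Main.v *)
Require Import Defs.
From mathcomp Require Import all_boot all_algebra.
From mathcomp Require Import perm fingroup action cyclic pgroup sylow zify.
Set Implicit Arguments. Unset Strict Implicit. Unset Printing Implicit Defensive.
Import GRing.Theory.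

(* In every K_n the corner labels around a vertex are pairwise distinct, so a
   face is determined by one of its vertices and the label there; hence an
   automorphism of a chain-connected patch that fixes one vertex is the
   identity. The two labels of an interior edge are distinct, so no automorphism
   flips an edge either. A nontrivial automorphism thus has a power of prime
   order p acting freely on the vertices, edges and faces of P, and p divides
   V - E + F. But this Euler characteristic is 1: over F_2, simple connectivity
   makes every 1-cocycle a coboundary, and the boundary map on faces is injective
   because every nonempty set of faces of K_n has a free edge. *)

(** * Combinatorics of the subdivision *)

Definition edge (f : face) (i : 'I_5) : nat * nat := nedge (f i) (f (i + 1)%R).

Lemma nedgeC a b : nedge a b = nedge b a.
Proof. by rewrite /nedge minnC maxnC. Qed.

Lemma nedge_lt a b : a < b -> nedge a b = (a, b).
Proof. by rewrite /nedge => /ltnW ab; rewrite (minn_idPl ab) (maxn_idPr ab). Qed.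

Lemma nedge_eq a b c d :
  nedge a b = nedge c d -> (a = c /\ b = d) \/ (a = d /\ b = c).
Proof. by rewrite /nedge => -[]; lia. Qed.

Lemma nedge_neq a b c d M : a < M -> M <= c -> M <= d -> (a, b) <> nedge c d.
Proof. by rewrite /nedge => aM cM dM []; lia. Qed.

Lemma ord5_ind (Q : 'I_5 -> Prop) :
  Q 0%R -> Q 1%R -> Q 2%:R%R -> Q 3%:R%R -> Q 4%:R%R -> forall i, Q i.
Proof.
move=> q0 q1 q2 q3 q4 [[|[|[|[|[|m]]]]] lt_m5] //.
- by rewrite (_ : Ordinal _ = 0%R) //; apply: val_inj.
- by rewrite (_ : Ordinal _ = 1%R) //; apply: val_inj.
- by rewrite (_ : Ordinal _ = 2%:R%R) //; apply: val_inj.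
- by rewrite (_ : Ordinal _ = 3%:R%R) //; apply: val_inj.
- by rewrite (_ : Ordinal _ = 4%:R%R) //; apply: val_inj.
Qed.

Lemma mem_all_edges fs e :
  reflect (exists2 f, f \in fs & exists i, e = edge f i) (e \in all_edges fs).
Proof.
rewrite mem_undup; apply: (iffP flatten_mapP) => -[f ffs].
  by case/mapP=> i _ ->; exists f => //; exists i.
by case=> i ->; exists f => //; apply: map_f; rewrite mem_enum.
Qed.

Lemma edge_in_all fs f i : f \in fs -> edge f i \in all_edges fs.
Proof. by move=> ffs; apply/mem_all_edges; exists f => //; exists i. Qed.

(* [good_edge] is the reason why the tiling has no label-preserving reflection
   across an edge; [good_free] excludes closed surfaces. *)
Record good (K : cplx) : Prop := Good {
  good_bound : {in K.2, forall (f : face) j, f j < K.1};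
  good_uniq : uniq K.2;
  good_inj : {in K.2, forall f : face, injective f};
  good_corner : {in K.2 &, forall (f g : face) j, f j = g j -> f = g};
  good_edge : {in K.2 &, forall f g i j, edge f i = edge g j ->
    (f = g /\ i = j) \/ (j = i + 2%:R \/ i = j + 2%:R)%R};
  good_free : forall (Q : seq face) g, {subset Q <= K.2} -> g \in Q ->
    exists f i, f \in Q /\
      forall g j, g \in Q -> edge g j = edge f i -> g = f /\ j = i }.

Lemma ord5_add_inj (b c : bool) (i : 'I_5) : (i + b%:R = i + c%:R)%R -> b = c.
Proof. by move/addrI; case: b; case: c. Qed.

(** * Preservation of [good] under one subdivision *)

Section Omega.
Variables (N : nat) (fs : seq face).
Hypothesis gK : good (N, fs).

Let E := all_edges fs.
Let F k := nth [ffun=> 0] fs k.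
Let mide k i := mid N E (F k i) (F k (i + 1)%R).
Let cn := cen N E.
Let ctr := central N E.
Let ptl k i := petal N E k (F k) i.

Lemma F_in k : k < size fs -> F k \in fs.
Proof. exact: mem_nth. Qed.

Lemma F_inj k l : k < size fs -> l < size fs -> F k = F l -> k = l.
Proof.
by move=> ks ls /eqP; rewrite nth_uniq ?(good_uniq gK) // => /eqP.
Qed.

Lemma F_lt k j : k < size fs -> F k j < N.
Proof. by move=> ks; apply: (good_bound gK (F_in ks)). Qed.

(** Vertex ids lie in three disjoint ranges: old vertices below [N], midpoints from [N] to below
    [N + size E], centres from there on. Comparing ranges tells the kinds of vertices apart. *)
Lemma mide_range k j : k < size fs -> N <= mide k j < N + size E.
Proof.
move=> ks; rewrite leq_addr /= ltn_add2l index_mem.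
exact: (edge_in_all j (F_in ks)).
Qed.

Lemma cn_ge k j : N + size E <= cn k j.
Proof. by rewrite /cn /cen -addnA leq_addr. Qed.

Lemma cn_lt k j : k < size fs -> cn k j < N + size E + 5 * size fs.
Proof. by rewrite /cn /cen; have := ltn_ord j; lia. Qed.

Lemma cn_inj k l i j : cn k i = cn l j -> k = l /\ i = j.
Proof.
rewrite /cn /cen => eq_c; have [li lj] := (ltn_ord i, ltn_ord j).
by split; [lia | apply: val_inj => /=; lia].
Qed.

(** Equal midpoints have equal positions in [E], so the two old edges coincide and [good_edge]
    applies. *)
Lemma mide_inj k l i j : k < size fs -> l < size fs -> mide k i = mide l j ->
  (k = l /\ i = j) \/ (j = i + 2%:R \/ i = j + 2%:R)%R.
Proof.
move=> ks ls /addnI eq_m.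
have eqe : edge (F k) i = edge (F l) j.
  rewrite -[LHS](nth_index (0, 0) (edge_in_all i (F_in ks))).
  by rewrite -[RHS](nth_index (0, 0) (edge_in_all j (F_in ls))); congr nth.
case: (good_edge gK (F_in ks) (F_in ls) eqe); last by right.
by case=> /(F_inj ks ls); left.
Qed.

Lemma ctrE k j : ctr k j = cn k (j - 1)%R.
Proof. by rewrite ffunE. Qed.

(** New edges come in three kinds, told apart by the ranges of their ends: half of an old edge (old
    vertex and midpoint), spoke (midpoint and centre), inner edge (two centres). *)
Lemma half_inner k l i j e : k < size fs ->
  (F k i, mide k j) <> nedge (cn l e) (cn l (e + 1)%R).
Proof.
move=> ks; apply: (@nedge_neq _ _ _ _ (N + size E)); rewrite ?cn_ge //.
exact: ltn_addr (F_lt i ks).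
Qed.

Lemma spoke_inner k l i e : k < size fs ->
  (mide k i, cn k i) <> nedge (cn l e) (cn l (e + 1)%R).
Proof.
move=> ks; apply: (@nedge_neq _ _ _ _ (N + size E)); rewrite ?cn_ge //.
by case/andP: (mide_range i ks).
Qed.

Lemma half_spoke k l i j e : k < size fs -> l < size fs ->
  (F k i, mide k j) <> (mide l e, cn l e).
Proof.
move=> ks ls [eqF _]; have := F_lt i ks.
by rewrite eqF ltnNge; case/andP: (mide_range e ls) => ->.
Qed.

Lemma ptlE k i d : ptl k i (i + d)%R =
  match nat_of_ord d with
  | 0 => F k i | 1 => mide k i | 2 => cn k i | 3 => cn k (i - 1)%R
  | _ => mide k (i - 1)%R end.
Proof. by rewrite ffunE (addrC i d) addrK /mide subrK. Qed.

Lemma ptl0 k i : ptl k i i = F k i.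
Proof. by rewrite -{2}[i]addr0 ptlE. Qed.
Lemma ptl1 k i : ptl k i (i + 1)%R = mide k i.
Proof. by rewrite ptlE. Qed.
Lemma ptl2 k i : ptl k i (i + 2%:R)%R = cn k i.
Proof. by rewrite ptlE. Qed.
Lemma ptl3 k i : ptl k i (i + 3%:R)%R = cn k (i - 1)%R.
Proof. by rewrite ptlE. Qed.
Lemma ptl4 k i : ptl k i (i + 4%:R)%R = mide k (i - 1)%R.
Proof. by rewrite ptlE. Qed.

Lemma ptl_lt k i j : k < size fs -> ptl k i j < N -> j = i.
Proof.
move=> ks; rewrite -[j](subrK i) [(_ - i + i)%R]addrC.
have mN e := (andP (mide_range e ks)).1.
have cN e : N <= cn k e by apply: leq_trans (cn_ge k e); rewrite leq_addr.
elim/ord5_ind: (j - i)%R; first by rewrite addr0.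
- by rewrite ptl1 ltnNge mN.
- by rewrite ptl2 ltnNge cN.
- by rewrite ptl3 ltnNge cN.
- by rewrite ptl4 ltnNge mN.
Qed.

(** The only old vertex of a petal is its tip, which carries the label [i]; the centre at label
    [i + 2] then gives the face index. *)
Lemma ptl_tag k l i j : k < size fs -> l < size fs ->
  ptl k i = ptl l j -> k = l /\ i = j.
Proof.
move=> ks ls eq_p; have ij : i = j.
  by apply: (@ptl_lt l) => //; rewrite -eq_p ptl0 F_lt.
by move: eq_p; rewrite -ij => eq_p; have := ptl2 k i; rewrite eq_p ptl2 => /cn_inj[].
Qed.

Lemma ctr_neq_ptl k l i : l < size fs -> ctr k <> ptl l i.
Proof.
move=> ls eq_c; have := F_lt i ls; rewrite -(ptl0 l i) -eq_c ctrE ltnNge.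
by rewrite (leq_trans _ (cn_ge _ _)) ?leq_addr.
Qed.

Let fs' := (omega (N, fs)).2.

Lemma fs'E : fs' = [seq (if o is Some i then ptl k i else ctr k) |
   k <- iota 0 (size fs), o <- None :: map Some (enum 'I_5)].
Proof.
rewrite /fs' /= -/E; congr flatten.
have -> : zip (iota 0 (size fs)) fs = [seq (k, F k) | k <- iota 0 (size fs)].
  rewrite -{2}[fs](mkseq_nth [ffun=> 0]) /mkseq.
  by elim: (iota _ _) => //= k s ->.
by rewrite -map_comp; apply: eq_map => k /=; rewrite /subdiv -map_comp.
Qed.

Lemma fs'P g : reflect
  (exists2 k, k < size fs & g = ctr k \/ exists i, g = ptl k i) (g \in fs').
Proof.
rewrite fs'E; apply: (iffP allpairsPdep) => [[k [o [ks _ ->]]] | [k ks gE]].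
  exists k; first by rewrite mem_iota in ks.
  by case: o => [i|]; [right; exists i | left].
have ki : k \in iota 0 (size fs) by rewrite mem_iota.
case: gE => [-> | [i ->]].
  by exists k, None; split; rewrite ?inE.
by exists k, (Some i); split => //; rewrite inE /= map_f ?mem_enum.
Qed.

(* In the labels of the petals and edges below, [e] is an edge label of the old
   face [F k] and the boolean selects one of the two petals at that edge. *)
Variant corner_spec (g : face) (j : 'I_5) : nat -> Prop :=
| CornerOld k of k < size fs & g = ptl k j : corner_spec g j (F k j)
| CornerMid k e (b : bool) of k < size fs & g = ptl k (e + b%:R)%R
    & j = (e + (~~ b)%:R)%R : corner_spec g j (mide k e)
| CornerCen k e (o : option bool) of k < size fs
    & g = (if o is Some b then ptl k (e + b%:R)%R else ctr k)
    & j = (e + (if o is Some b then if b then 4 else 2 else 1)%:R)%R :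
    corner_spec g j (cn k e).

Lemma cornerP g j : g \in fs' -> corner_spec g j (g j).
Proof.
case/fs'P => k ks [-> | [i ->]].
  by rewrite ctrE; apply: (@CornerCen _ _ _ _ None) => //; rewrite subrK.
have -> : j = (i + (j - i))%R by rewrite addrC subrK.
elim/ord5_ind: (j - i)%R.
- by rewrite addr0 ptl0; apply: CornerOld.
- rewrite ptl1; apply: (@CornerMid _ _ _ _ false) => //; by rewrite addr0.
- rewrite ptl2; apply: (@CornerCen _ _ _ _ (Some false)) => //; by rewrite addr0.
- rewrite ptl3; apply: (@CornerCen _ _ _ _ (Some true)) => //.
    by rewrite subrK.
  by rewrite -addrA; congr (_ + _)%R; apply: val_inj.
- rewrite ptl4; apply: (@CornerMid _ _ _ _ true) => //.
    by rewrite subrK.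
  by rewrite -addrA; congr (_ + _)%R; apply: val_inj.
Qed.

(** The first two kinds are sorted pairs because of the id ranges; two centres need [nedge], since
    their indices wrap mod 5. A half edge keeps the label of the old edge, which lets [good_edge]
    pass to the subdivision. *)
Variant edge_spec (g : face) (j : 'I_5) : nat * nat -> Prop :=
| EdgeHalf k (b : bool) of k < size fs & g = ptl k (j + b%:R)%R :
    edge_spec g j (F k (j + b%:R)%R, mide k j)
| EdgeSpoke k e (b : bool) of k < size fs & g = ptl k (e + b%:R)%R
    & j = (e + (if b then 4 else 1)%:R)%R :
    edge_spec g j (mide k e, cn k e)
| EdgeInner k e (b : bool) of k < size fs
    & g = (if b then ptl k (e + 1)%R else ctr k)
    & j = (e + (if b then 3 else 1)%:R)%R :
    edge_spec g j (nedge (cn k e) (cn k (e + 1)%R)).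

Lemma edgeP g j : g \in fs' -> edge_spec g j (edge g j).
Proof.
case/fs'P => k ks [-> | [i ->]].
  rewrite /edge !ctrE addrAC.
  by apply: (@EdgeInner _ _ _ _ false) => //; rewrite subrK.
have rF l := F_lt l ks; have rM l := mide_range l ks; have rC := cn_ge k.
have -> : j = (i + (j - i))%R by rewrite addrC subrK.
have i5 (a b : 'I_5) : (a + 1 = b -> i + a + 1 = i + b)%R by move=> <-; rewrite addrA.
rewrite /edge; elim/ord5_ind: (j - i)%R.
- rewrite addr0 ptl0 ptl1 nedge_lt; last by have := rF i; have := rM i; lia.
  by have := @EdgeHalf (ptl k i) i k false ks; rewrite addr0; apply.
- rewrite (i5 _ 2%:R%R) // ptl1 ptl2 nedge_lt; last by have := rM i; have := rC i; lia.
  by apply: (@EdgeSpoke _ _ _ _ false); rewrite ?addr0.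
- rewrite (i5 _ 3%:R%R); last exact: val_inj.
  rewrite ptl2 ptl3 nedgeC.
  have := @EdgeInner (ptl k i) (i + 2%:R)%R k (i - 1)%R true ks.
  rewrite subrK; apply=> //.
  by rewrite -addrA; congr (_ + _)%R; apply: val_inj.
- rewrite (i5 _ 4%:R%R); last exact: val_inj.
  rewrite ptl3 ptl4 nedgeC nedge_lt; last first.
    by have := rM (i - 1)%R; have := rC (i - 1)%R; lia.
  apply: (@EdgeSpoke _ _ _ _ true); rewrite ?subrK //.
  by rewrite -addrA; congr (_ + _)%R; apply: val_inj.
- rewrite (i5 _ 0%R); last exact: val_inj.
  rewrite addr0 ptl4 ptl0 nedgeC nedge_lt; last first.
    by have := rM (i - 1)%R; have := rF i; lia.
  rewrite (_ : i + 4%:R = i - 1 :> 'I_5)%R; last by congr (_ + _)%R; apply: val_inj.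
  by have := @EdgeHalf (ptl k i) (i - 1)%R k true ks; rewrite subrK; apply.
Qed.

(** At an old vertex the labels are the old ones. At a centre the three labels are [e + 1], [e + 2]
    and [e + 4]. At a midpoint one side has the labels [e] and [e + 1], and a second side has this
    pair shifted by 2 either way, hence disjoint from it mod 5. *)
Lemma omega_corner : {in fs' &, forall (g h : face) j, g j = h j -> g = h}.
Proof.
move=> g h gin hin j.
case: (cornerP j gin) => [k ks gE | k e b ks gE jE | k e o ks gE jE];
case: (cornerP j hin) => [l ls hE | l e' b' ls hE jE' | l e' o' ls hE jE'] eq_c.
- by rewrite gE hE (F_inj ks ls (good_corner gK (F_in ks) (F_in ls) eq_c)).
- by have := mide_range e' ls; have := F_lt j ks; lia.
- by have := cn_ge l e'; have := F_lt j ks; lia.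
- by have := mide_range e ks; have := F_lt j ls; lia.
- case: (mide_inj ks ls eq_c) => [[kl ee'] | ee'].
    rewrite gE hE -kl -ee'; congr (ptl _ (_ + _%:R)%R).
    by move: jE'; rewrite jE -ee' => /ord5_add_inj; case: b {gE jE}; case: b' {hE}.
  by move: jE'; rewrite jE; case: ee' => ->; rewrite -addrA => /addrI;
    case: b {gE jE}; case: b' {hE}.
- by have := mide_range e ks; have := cn_ge l e'; lia.
- by have := cn_ge k e; have := F_lt j ls; lia.
- by have := mide_range e' ls; have := cn_ge k e; lia.
- case: (cn_inj eq_c) => kl ee'; rewrite gE hE -kl -ee'.
  move: jE'; rewrite jE -ee' => /addrI.
  by case: o {gE jE} => [[]|]; case: o' {hE} => [[]|].
Qed.

Lemma omega_inj : {in fs', forall g : face, injective g}.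
Proof.
move=> g /fs'P[k ks [-> | [i ->]]] x y.
  by rewrite !ctrE => /cn_inj[_ /addIr].
have rF l := F_lt l ks; have rM l := mide_range l ks; have rC := cn_ge k.
have {rF rM rC} := (rF i, rM i, rM (i - 1)%R, rC i, rC (i - 1)%R).
case=> -[] [] [r1 r2 r3 r4 r5].
rewrite -[x](subrK i) -[y](subrK i) ![(_ - i + i)%R]addrC.
suff ptl_inj d d' : ptl k i (i + d)%R = ptl k i (i + d')%R :> nat -> d = d'.
  by move/ptl_inj ->.
rewrite !ptlE; elim/ord5_ind: d; elim/ord5_ind: d' => //= eq_c;
  try solve [exfalso; move: r1 r2 r3 r4 r5 eq_c; move: (F k i) (mide k i)
    (mide k (i - 1)%R) (cn k i) (cn k (i - 1)%R) => *; lia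
    | case/cn_inj: eq_c => _ /eqP;
     by rewrite ?[_ == (i - 1)%R]eq_sym -subr_eq0 addrAC subrr sub0r oppr_eq0].
(* The surviving cases equate the two midpoints of a petal: their old labels [i - 1] and [i] would
   be equal or differ by 2 mod 5. *)
- case: (mide_inj ks ks eq_c) => [[_]|[]] /eqP.
  + by rewrite eq_sym -subr_eq0 addrAC subrr.
  + by rewrite -subr_eq0 opprD addrACA subrr.
  + by rewrite -addrA -subr_eq0 opprD addNKr.
- case: (mide_inj ks ks eq_c) => [[_]|[]] /eqP.
  + by rewrite -subr_eq0 addrAC subrr.
  + by rewrite -addrA -subr_eq0 opprD addNKr.
  + by rewrite -subr_eq0 opprD addrACA subrr.
Qed.

Lemma omega_inner k e h j : h \in fs' ->
  edge h j = nedge (cn k e) (cn k (e + 1)%R) ->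
  exists b : bool, h = (if b then ptl k (e + 1)%R else ctr k) /\
    j = (e + (if b then 3 else 1)%:R)%R.
Proof.
move=> hin.
case: (edgeP j hin) => [l b ls hE | l e' b ls hE jE | l e' b ls hE jE].
- by move/(half_inner ls).
- by move/(spoke_inner ls).
- case/nedge_eq => -[/cn_inj[kl e1] /cn_inj[_ e2]]; first by exists b; rewrite -kl -e1.
  (* Matching the ends crosswise forces [e + 2 = e] mod 5. *)
  by move: e2; rewrite e1 -[in RHS](addr0 e) -addrA => /addrI.
Qed.

(** Half edges inherit the alternative from the old edge. A spoke has labels [e + 1] and [e + 4] in
    its two petals, an inner edge [e + 1] and [e + 3] in its two faces; either pair differs by 2 mod
    5. *)
Lemma omega_edge : {in fs' &, forall g h i j, edge g i = edge h j ->
    (g = h /\ i = j) \/ (j = i + 2%:R \/ i = j + 2%:R)%R}.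
Proof.
move=> g h gin hin i j.
case: (edgeP i gin) => [k b ks gE | k e b ks gE iE | k e b ks gE iE].
- case: (edgeP j hin) => [l b' ls hE | l e' b' ls hE jE | l e' b' ls hE jE].
  + case=> eqF eqM; case: (mide_inj ks ls eqM) => [[kl ij]|]; last by right.
    left; split=> //; rewrite gE hE -kl -ij; congr (ptl _ (_ + _%:R)%R).
    by move: eqF; rewrite -kl -ij => /(good_inj gK (F_in ks)) /ord5_add_inj->.
  + by move/(half_spoke ks ls).
  + by move/(half_inner ks).
- case: (edgeP j hin) => [l b' ls hE | l e' b' ls hE jE | l e' b' ls hE jE].
  + by move/esym/(half_spoke ls ks).
  + case=> _ /cn_inj[kl ee']; rewrite gE hE iE jE -kl -ee'.
    case: b {gE iE}; case: b' {hE jE}; [by left | right | right | by left].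
      by left; rewrite -addrA; congr (_ + _)%R; apply: val_inj.
    by right; rewrite -addrA; congr (_ + _)%R; apply: val_inj.
  + by move/(spoke_inner ks).
- move/esym/(omega_inner hin) => [b' [hE jE]]; rewrite gE hE iE jE.
  case: b {gE iE}; case: b' {hE jE}; [by left | right | right | by left].
    by right; rewrite -addrA; congr (_ + _)%R; apply: val_inj.
  by left; rewrite -addrA; congr (_ + _)%R; apply: val_inj.
Qed.

Lemma omega_uniq : uniq fs'.
Proof.
rewrite fs'E; apply: allpairs_uniq_dep => [|k _|].
- exact: iota_uniq.
- rewrite /= map_inj_uniq ?enum_uniq => [|? ? []//].
  by apply/andP; split=> //; apply/negP => /mapP[].
- move=> _ _ /allpairsPdep[k [o [ks _ ->]]] /allpairsPdep[l [o' [ls _ ->]]] /=.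
  rewrite !mem_iota /= !add0n in ks ls.
  case: o => [i|]; case: o' => [j|] eq_g.
  + by case: (ptl_tag ks ls eq_g) => -> ->.
  + by case: (ctr_neq_ptl ks (esym eq_g)).
  + by case: (ctr_neq_ptl ls eq_g).
  + by have := ctrE k 0%R; rewrite eq_g ctrE => /cn_inj[-> _].
Qed.

(** If [Q] contains all or none of the six pieces of each old face, it is the subdivision of a set
    of old faces, and half of a free old edge is free. Otherwise [Q] separates a central pentagon
    from one of its petals, and their common inner edge is free. *)
Lemma omega_free (Q : seq face) g : {subset Q <= fs'} -> g \in Q ->
    exists f i, f \in Q /\
      forall g j, g \in Q -> edge g j = edge f i -> g = f /\ j = i.
Proof.
move=> Qfs gQ.
pose bal k := [forall i, (ptl k i \in Q) == (ctr k \in Q)].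
have [/allP balQ | /allPn[k]] := boolP (all bal (iota 0 (size fs))).
  pose Q' := [seq F k | k <- iota 0 (size fs) & ctr k \in Q].
  have Q'P k i : k < size fs -> ptl k i \in Q -> F k \in Q'.
    move=> ks pQ; apply: map_f; rewrite mem_filter mem_iota ks !andbT.
    have /forallP/(_ i)/eqP<- : bal k by apply: balQ; rewrite mem_iota.
    by rewrite pQ.
  have Q'sub : {subset Q' <= fs}.
    move=> f /mapP[k]; rewrite mem_filter mem_iota => /andP[_ ks] ->.
    exact: F_in.
  have [f0 f0Q'] : exists f0, f0 \in Q'.
    have /fs'P[k ks gE] := Qfs _ gQ; exists (F k).
    apply: (Q'P k 0%R) => //.
    have /forallP bk : bal k by apply: balQ; rewrite mem_iota.
    rewrite (eqP (bk _)); case: gE => [<- // | [i gE]].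
    by rewrite -(eqP (bk i)) -gE.
  have [f [i [fQ' f_free]]] := good_free gK Q'sub f0Q'.
  have /mapP[k] := fQ'; rewrite mem_filter mem_iota => /andP[kQ ks] fE.
  have pQ : ptl k i \in Q.
    have /forallP bk : bal k by apply: balQ; rewrite mem_iota.
    by rewrite (eqP (bk i)).
  exists (ptl k i), i; split=> // h j hQ.
  have [r1 r2] := (F_lt i ks, mide_range i ks).
  have r3 := F_lt (i + 1)%R ks.
  have -> : edge (ptl k i) i = (F k i, mide k i).
    by rewrite /edge ptl0 ptl1 nedge_lt //; lia.
  case: (edgeP j (Qfs _ hQ)) => [l b ls hE | l e b ls hE jE | l e b ls hE jE].
  + case=> eqF eqM.
    have lQ' : F l \in Q' by apply: (Q'P _ (j + b%:R)%R ls); rewrite -hE.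
    have eqe : edge (F l) j = edge f i.
      rewrite fE; move: eqM => /addnI eqM.
      rewrite -[LHS](nth_index (0, 0) (edge_in_all j (F_in ls))).
      by rewrite -[RHS](nth_index (0, 0) (edge_in_all i (F_in ks))); congr nth.
    have [lk ji] := f_free _ _ lQ' eqe; split=> //.
    (* The old end of the half edge decides which of the two petals along the old edge is meant. *)
    move: eqF; rewrite lk fE => /(good_inj gK (F_in ks)) jbi.
    by rewrite hE jbi; congr ptl; apply: F_inj; rewrite ?lk.
  + by move/esym/(half_spoke ks ls).
  + by move/esym/(half_inner ks).
rewrite mem_iota /= add0n => ks; rewrite negb_forall => /existsP[i].
have ctr_edge : edge (ctr k) i = nedge (cn k (i - 1)%R) (cn k (i - 1 + 1)%R).
  by rewrite /edge !ctrE addrAC.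
(* The label is [i + 2], written in the form that [omega_inner] returns for [e = i - 1]. *)
have ptl_edge : edge (ptl k i) (i - 1 + 3%:R)%R = nedge (cn k (i - 1)%R) (cn k (i - 1 + 1)%R).
  rewrite /edge nedgeC subrK -[in RHS](ptl2 k i) -(ptl3 k i).
  by congr (nedge (ptl _ _ _) (ptl _ _ _)); rewrite -!addrA; congr (_ + _)%R;
    apply: val_inj.
case pQ: (ptl k i \in Q); case cQ: (ctr k \in Q) => // _.
  exists (ptl k i), (i - 1 + 3%:R)%R; split=> // h j hQ.
  rewrite ptl_edge => /(omega_inner (Qfs _ hQ)) [[] []]; first by rewrite subrK.
  by move=> hE; rewrite -hE hQ in cQ.
exists (ctr k), i; split=> // h j hQ.
rewrite ctr_edge => /(omega_inner (Qfs _ hQ)) [[] []]; rewrite subrK //.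
by move=> hE; rewrite -hE hQ in pQ.
Qed.

Lemma omega_bound : {in fs', forall (g : face) j, g j < (omega (N, fs)).1}.
Proof.
move=> g gin j /=; rewrite -/E.
case: (cornerP j gin) => [k ks _ | k e b ks _ _ | k e o ks _ _].
- by have := F_lt j ks; lia.
- by have := mide_range e ks; lia.
- exact: cn_lt.
Qed.

End Omega.

(** * Goodness of every [Kn n], by induction *)

Lemma omega_good K : good K -> good (omega K).
Proof.
case: K => N fs gK; split.
- exact: omega_bound.
- exact: omega_uniq.
- exact: omega_inj.
- exact: omega_corner.
- exact: omega_edge.
- exact: omega_free.
Qed.

Lemma K0_good : good K0.
Proof.
have K0P f : f \in K0.2 -> f = [ffun j : 'I_5 => nat_of_ord j].
  by rewrite inE => /eqP.
have f_inj : injective [ffun j : 'I_5 => nat_of_ord j].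
  by move=> i j; rewrite !ffunE => /val_inj.
have edge_inj : injective (edge [ffun j : 'I_5 => nat_of_ord j]).
  move=> i j; rewrite /edge => /nedge_eq[[/f_inj]//|[/f_inj -> /f_inj /eqP]].
  by rewrite -addrA -subr_eq0 addrAC subrr.
split=> //=.
- by move=> f /K0P-> j; rewrite ffunE.
- by move=> f /K0P->.
- by move=> f g /K0P-> /K0P->.
- by move=> f g /K0P-> /K0P-> i j /edge_inj; left.
- move=> Q f QK fQ; exists f, 0%R; split=> // g j gQ.
  have [-> ->] := (K0P _ (QK _ gQ), K0P _ (QK _ fQ)).
  by move/edge_inj.
Qed.

Lemma Kn_good n : good (Kn n).
Proof. by elim: n => [|n IHn]; [apply: K0_good | apply: omega_good]. Qed.

(** * Euler characteristic *)

Local Notation F2 := 'F_2.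

Lemma F2_addxx (x : F2) : (x + x = 0)%R.
Proof. by apply: addrr_pchar2; apply: pchar_Fp. Qed.

Lemma F2_add0 (x y : F2) : (x + y = 0 -> x = y)%R.
Proof. by move=> xy0; rewrite -[x]addr0 -(F2_addxx y) addrA xy0 add0r. Qed.

(** Rank-nullity for an exact complex 0 -> K -> C^0 -> C^1 -> C^2 -> 0, cochains being row vectors:
    the hypotheses give [\rank A = #|V| - 1], the equality of [kermx B] with the row space of [A],
    and [\rank B = #|F|]. *)
Lemma exact_cochain_card (K : fieldType) (V E F : finType)
    (d0 : V -> E -> K) (d1 : E -> F -> K) :
  0 < #|V| ->
  (forall e, \sum_v d0 v e = 0)%R ->
  (forall u : V -> K, (forall e, \sum_v u v * d0 v e = 0)%R ->
    exists c, forall v, u v = c) ->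
  (forall v f, \sum_e d0 v e * d1 e f = 0)%R ->
  (forall w : E -> K, (forall f, \sum_e w e * d1 e f = 0)%R ->
    exists u : V -> K, forall e, w e = \sum_v u v * d0 v e)%R ->
  (forall t : F -> K, exists w : E -> K,
    forall f, \sum_e w e * d1 e f = t f)%R ->
  #|V| + #|F| = #|E| + 1.
Proof.
move=> V_gt0 h0 h0' h01 h1 h2.
pose A : 'M[K]_(#|V|, #|E|) := (\matrix_(i, j) d0 (enum_val i) (enum_val j))%R.
pose B : 'M[K]_(#|E|, #|F|) := (\matrix_(i, j) d1 (enum_val i) (enum_val j))%R.
have sum_enum (T : finType) (G : T -> K) :
    (\sum_(i < #|T|) G (enum_val i) = \sum_x G x)%R.
  by rewrite [RHS](reindex (@enum_val T T)) //; apply/onW_bij/enum_val_bij.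
pose rv (T : finType) (u : T -> K) : 'rV[K]_#|T| := (\row_i u (enum_val i))%R.
have rvE (T : finType) (u : 'rV_#|T|) : u = rv T (fun x => u 0%R (enum_rank x)).
  by apply/rowP => i; rewrite mxE enum_valK.
have rowA u : (rv V u *m A = rv E (fun e => \sum_v u v * d0 v e))%R.
  apply/rowP => j; rewrite !mxE -[RHS]sum_enum; apply: eq_bigr => i _.
  by rewrite !mxE.
have rowB w : (rv E w *m B = rv F (fun f => \sum_e w e * d1 e f))%R.
  apply/rowP => j; rewrite !mxE -[RHS]sum_enum; apply: eq_bigr => i _.
  by rewrite !mxE.
have row_inj (T : finType) (u u' : T -> K) : rv T u = rv T u' -> u =1 u'.
  by move/rowP => eq_u x; have := eq_u (enum_rank x); rewrite !mxE enum_rankK.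
have row_eq (T : finType) (u u' : T -> K) : u =1 u' -> rv T u = rv T u'.
  by move=> eq_u; apply/rowP=> i; rewrite !mxE.
have row0 (T : finType) : rv T (fun=> 0%R) = 0%R by apply/rowP=> i; rewrite !mxE.
have rkA : \rank (kermx A) = 1%N.
  have -> : \rank (kermx A) = \rank (rv V (fun=> 1%R)).
    apply/eqP; rewrite eqn_leq; apply/andP; split; apply: mxrankS.
      apply/rV_subP => u /sub_kermxP; rewrite [u]rvE rowA -[RHS]row0.
      move=> /row_inj /h0'[c uc].
      rewrite (_ : rv V _ = c *: rv V (fun=> 1))%R ?scalemx_sub //.
      by apply/rowP => i; rewrite !mxE -(uc (enum_val i)) enum_valK mulr1.
    apply/sub_kermxP; rewrite rowA -row0; apply: row_eq => e.
    by rewrite -[RHS](h0 e); apply: eq_bigr => v _; rewrite mul1r.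
  rewrite rank_rV; apply/eqP; rewrite eqb1; apply/eqP.
  rewrite -row0 => /row_inj; case/card_gt0P: V_gt0 => v _ /(_ v)/eqP.
  by rewrite oner_eq0.
have AB : (A *m B = 0)%R.
  apply/matrixP => i j; rewrite !mxE -[RHS](h01 (enum_val i) (enum_val j)) -[RHS]sum_enum.
  by apply: eq_bigr => k _; rewrite !mxE.
have kerB : (kermx B :=: A)%MS.
  apply/eqmxP/andP; split; last by apply/sub_kermxP.
  apply/rV_subP => w /sub_kermxP; rewrite [w]rvE rowB -[RHS]row0.
  move=> /row_inj /h1[u wu]; apply/submxP; exists (rv V u).
  by rewrite rowA; apply: row_eq.
have rkB : \rank B = #|F|.
  apply/eqP; rewrite -[_ == _]/(row_full B) -sub1mx; apply/rV_subP => t _.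
  rewrite [t]rvE; have [w wt] := h2 (fun f => t 0%R (enum_rank f)).
  by apply/submxP; exists (rv E w); rewrite rowB; apply: row_eq.
have := mxrank_ker B; have := mxrank_ker A; rewrite rkA kerB rkB.
(* Subtraction in [mxrank_ker] truncates at 0, so the row bounds on the ranks are supplied. *)
have := rank_leq_row A; have := rank_leq_row B; rewrite rkB.
by lia.
Qed.

(** [g] generates a cyclic [p]-group of permutations, and the number of points fixed by this group
    is congruent to [#|T|] mod [p]. *)
Lemma fpfree_prime_dvd (T : finType) (p : nat) (g : T -> T) :
  prime p -> (forall x, iter p g x = x) -> (forall x, g x <> x) -> p %| #|T|.
Proof.
move=> p_pr gp g_free.
have g_inj : injective g.
  move=> x y eq_g; rewrite -(gp x) -(gp y) -(prednK (prime_gt0 p_pr)).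
  by rewrite !iterSr eq_g.
pose s := perm g_inj.
have sp : (s ^+ p = 1)%g.
  apply/permP => x; rewrite permX perm1 -[RHS]gp.
  by apply: eq_iter => y; rewrite permE.
have pG : (p.-group <[s]>)%g.
  rewrite /pgroup -orderE; apply: (@pnat_dvd _ p); last exact: pnat_id.
  by rewrite order_dvdn sp.
have := pgroup_fix_mod pG (_ : [acts <[s]>, on [set: T] | 'P]%g).
rewrite cardsT => /(_ _)/eqP; rewrite (_ : #|_| = 0).
  by rewrite mod0n => H; apply: H; apply/actsP => a _ x; rewrite !inE.
apply/eqP; rewrite cards_eq0 -subset0; apply/subsetP => x.
rewrite in_setI => /andP[_ /afixP /(_ s (cycle_id s)) /=].
by rewrite /aperm permE => /g_free.
Qed.

Lemma vertsP (P : seq face) x :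
  reflect (exists2 f, f \in P & exists j, x = f j) (x \in verts P).
Proof.
apply: (iffP flatten_mapP) => -[f fP].
  by case/mapP=> j _ ->; exists f => //; exists j.
by case=> j ->; exists f => //; apply: map_f; rewrite mem_enum.
Qed.

Lemma mem_verts (P : seq face) f j : f \in P -> f j \in verts P.
Proof. by move=> fP; apply/vertsP; exists f => //; exists j. Qed.

Lemma nedge_sum (h : nat -> F2) a b :
  (h (nedge a b).1 + h (nedge a b).2 = h a + h b)%R.
Proof. by rewrite /nedge /=; case: (leqP a b) => // _; rewrite addrC. Qed.

Lemma nedge_map (h : nat -> nat) a b :
  nedge (h (nedge a b).1) (h (nedge a b).2) = nedge (h a) (h b).
Proof.
rewrite [in LHS](_ : nedge a b = (minn a b, maxn a b)) //=.
by case: (leqP a b) => // _; rewrite nedgeC.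
Qed.

Lemma all_edges_verts P e : e \in all_edges P -> e.1 \in verts P /\ e.2 \in verts P.
Proof.
case/mem_all_edges=> f fP [i ->]; rewrite /edge /nedge /=.
by have [vi vi1] := (mem_verts i fP, mem_verts (i + 1)%R fP); case: leqP.
Qed.

Lemma adjP P a b : adj P a b <-> nedge a b \in all_edges P.
Proof.
split=> [[f fP [j ab]] | /mem_all_edges[f fP [j /nedge_eq ab]]].
  by case: ab => -[<- <-]; [|rewrite nedgeC]; apply: edge_in_all.
by exists f => //; exists j; case: ab => -[-> ->]; [left | right].
Qed.

Section SeqSubSum.
Variables (T : choiceType) (s : seq T).
Implicit Types (u : seq_sub s -> F2).

(** Extension by zero: a cochain on the finite type [seq_sub s] can be evaluated at plain vertices,
    edges or faces. *)
Definition ext u (x : T) : F2 := if insub x is Some y then u y else 0%R.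

Lemma ext_val u y : ext u (val y) = u y.
Proof. by rewrite /ext valK. Qed.

Lemma ext_restrict (h : T -> F2) x : x \in s -> ext (fun y => h (val y)) x = h x.
Proof. by move=> xs; apply: (ext_val (fun y => h (val y)) (SeqSub xs)). Qed.

Lemma sum_ext u x : x \in s -> (\sum_y u y * (val y == x)%:R = ext u x)%R.
Proof.
move=> xs; rewrite (bigD1 (SeqSub xs)) //= eqxx mulr1 big1 => [|y].
  by rewrite addr0 -(ext_val u (SeqSub xs)).
by rewrite -val_eqE /= => /negPf->; rewrite mulr0.
Qed.

End SeqSubSum.

(** * Sums of a 1-cochain along edge paths *)

Fixpoint wsum (W : nat * nat -> F2) (x : nat) (s : seq nat) : F2 :=
  if s is y :: s' then (W (nedge x y) + wsum W y s')%R else 0%R.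

(** [htpc] works on vertex lists that include the starting vertex, whereas [epath] takes it as a
    separate argument. *)
Definition psum W (s : seq nat) : F2 := if s is x :: s' then wsum W x s' else 0%R.

Lemma wsum_cat W x s t : wsum W x (s ++ t) = (wsum W x s + wsum W (last x s) t)%R.
Proof. by elim: s x => [|y s IHs] x /=; rewrite ?add0r // IHs addrA. Qed.

Lemma psum_cat W s1 a s2 :
  psum W (s1 ++ a :: s2) = (psum W (rcons s1 a) + wsum W a s2)%R.
Proof.
case: s1 => [|x s1] /=; first by rewrite add0r.
by rewrite -cat_rcons wsum_cat last_rcons.
Qed.

Lemma epath_cat P x s t :
  epath P x s -> epath P (last x s) t -> epath P x (s ++ t).
Proof. by elim: s x => //= y s IHs x [xy ys] st; split=> //; apply: IHs. Qed.

Section Cocycle.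
Variables (P : seq face) (W : nat * nat -> F2).
Hypothesis W_cocycle : forall f, f \in P -> (\sum_i W (edge f i) = 0)%R.

Lemma wsum_face f j s : f \in P ->
  wsum W (f j) [:: f (j + 1)%R, f (j + 2)%R, f (j + 3)%R, f (j + 4)%R, f j & s]
  = wsum W (f j) s.
Proof.
move=> fP; have := W_cocycle fP; rewrite (reindex_inj (addrI j)) /= !big_ord_recl big_ord0.
have Wj (a c d : 'I_5) : a = c -> (a + 1 = d)%R ->
    W (edge f (j + a)%R) = W (nedge (f (j + c)%R) (f (j + d)%R)).
  by move=> -> <-; rewrite /edge addrA.
have f0 : f j = f (j + 0)%R by rewrite addr0.
rewrite (Wj _ 0 1)%R; try exact: val_inj.
rewrite (Wj _ 1 2)%R; try exact: val_inj.
rewrite (Wj _ 2 3)%R; try exact: val_inj.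
rewrite (Wj _ 3 4)%R; try exact: val_inj.
rewrite (Wj _ 4 0)%R; try exact: val_inj.
by rewrite -f0 addr0 !addrA => ->; rewrite add0r.
Qed.

(** A backtrack [a, b, a] crosses the same edge twice, which cancels over F_2; the circuit of a face
    contributes its cocycle sum, which is zero. *)
Lemma psum_htpc s t : htpc P s t -> psum W s = psum W t.
Proof.
elim=> // {s t} [s t [s1 s2 a b _ | s1 s2 f j fP] | s t u _ -> _ ->] //.
  by rewrite /= !psum_cat /= nedgeC (addrA (W _)) F2_addxx add0r.
by rewrite /= !psum_cat wsum_face.
Qed.

(** The potential of a vertex is the sum of [W] along a chosen path from a base vertex. *)
Lemma cocycle_potential : simply_connected P ->
  exists u : nat -> F2, forall a b, adj P a b -> (W (nedge a b) = u a + u b)%R.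
Proof.
case: P W_cocycle psum_htpc => [|f0 P'] Wc psumP; first by exists (fun=> 0%R) => a b [].
set Q := f0 :: P' in Wc psumP * => -[Qc Qs].
have v0Q : f0 0%R \in verts Q by apply: mem_verts; rewrite mem_head.
have [s sP] : exists s : seq_sub (verts Q) -> seq nat,
    forall v, epath Q (f0 0%R) (s v) /\ last (f0 0%R) (s v) = val v.
  apply: (@fin_all_exists _ (fun=> seq nat)
      (fun v s => epath Q (f0 0%R) s /\ last (f0 0%R) s = val v)) => v.
  by apply: Qc => //; apply: valP.
pose u v := wsum W (f0 0%R) (s v); exists (ext u) => a b ab.
have [f fQ [j abf]] := ab.
have aQ : a \in verts Q.
  by case: abf => -[e1 e2]; first [rewrite -e1 | rewrite -e2];
    apply: mem_verts.
have bQ : b \in verts Q.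
  by case: abf => -[e1 e2]; first [rewrite -e1 | rewrite -e2];
    apply: mem_verts.
rewrite (ext_val u (SeqSub aQ)) (ext_val u (SeqSub bQ)) /u.
have [pa la] := sP (SeqSub aQ); have [pb lb] := sP (SeqSub bQ).
rewrite /= in la lb.
(* One return path [t] from [b] closes both the path to [b] and the path to [a] extended by the
   edge; both loops are null-homotopic, so comparing their sums gives the claim. *)
have [t [pt lt]] := Qc b _ bQ v0Q.
have loop_b : wsum W (f0 0%R) (s (SeqSub bQ) ++ t) = 0%R.
  apply: (psumP (f0 0%R :: _) [:: f0 0%R]); apply: Qs => //.
    by apply: epath_cat; rewrite ?lb.
  by rewrite last_cat lb.
have loop_a : wsum W (f0 0%R) (s (SeqSub aQ) ++ b :: t) = 0%R.
  apply: (psumP (f0 0%R :: _) [:: f0 0%R]); apply: Qs => //.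
    by apply: epath_cat; rewrite ?la.
  by rewrite last_cat la.
move: loop_a loop_b; rewrite !wsum_cat la lb /= => /F2_add0-> /F2_add0->.
by rewrite -addrA F2_addxx addr0.
Qed.

End Cocycle.

(** Induction on the size of [Q], peeling off a face with a free edge: changing [W] on that edge
    corrects the sum at this face and affects no other face of [Q]. This is dual to the injectivity
    of the boundary map. *)
Lemma coboundary_onto n (t : face -> F2) (Q : seq face) :
  {subset Q <= Kfaces n} ->
  exists W : nat * nat -> F2, {in Q, forall f, (\sum_i W (edge f i) = t f)%R}.
Proof.
have [m] := ubnP (size Q); elim: m Q => // m IHm [|g Q'] szQ QK.
  by exists (fun=> 0%R).
set Q := g :: Q' in szQ QK *.
have [f [i [fQ f_free]]] := good_free (Kn_good n) QK (mem_head g Q').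
have sub_rem : {subset [seq h <- Q | h != f] <= Q}.
  by move=> h; rewrite mem_filter => /andP[].
have [|h /sub_rem /QK //|W WP] := IHm [seq h <- Q | h != f].
  rewrite -ltnS; apply: leq_trans szQ; rewrite ltnS size_filter.
  rewrite -(count_predC (pred1 f) Q) -add1n leq_add2r.
  by rewrite -has_count has_pred1.
exists (fun e => W e + (e == edge f i)%:R * (t f - \sum_j W (edge f j)))%R.
move=> h hQ; rewrite big_split /= -mulr_suml.
have [-> | hf] := eqVneq h f.
  rewrite (_ : \sum_j (edge f j == edge f i)%:R = 1)%R; first by rewrite mul1r addrC subrK.
  rewrite (bigD1 i) //= eqxx big1 ?addr0 // => j ji.
  by case: eqP => // /(f_free f j fQ)[_ /eqP]; rewrite (negPf ji).
rewrite (_ : \sum_j (edge h j == edge f i)%:R = 0)%R; last first.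
  by apply: big1 => j _; case: eqP => // /(f_free h j hQ)[/eqP]; rewrite (negPf hf).
by rewrite mul0r addr0 WP // mem_filter hf.
Qed.

(** The cellular cochain complex over F_2, hence without orientations, is exact. [seq_sub] counts
    distinct elements, although [verts P] lists a vertex once per corner. *)
Lemma euler_patch n P : patch_of n P -> simply_connected P -> P <> [::] ->
  #|{: seq_sub (verts P)}| + #|{: seq_sub P}| = #|{: seq_sub (all_edges P)}| + 1.
Proof.
move=> /allP PK Ps P0.
pose d0 (v : seq_sub (verts P)) (e : seq_sub (all_edges P)) : F2 :=
  ((val v == (val e).1)%:R + (val v == (val e).2)%:R)%R.
pose d1 (e : seq_sub (all_edges P)) (f : seq_sub P) : F2 :=
  (\sum_i (val e == edge (val f) i)%:R)%R.
have d0E u e : (\sum_v u v * d0 v e = ext u (val e).1 + ext u (val e).2)%R.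
  have [e1 e2] := all_edges_verts (valP e).
  rewrite -(sum_ext u e1) -(sum_ext u e2) -big_split /=.
  by apply: eq_bigr => v _; rewrite mulrDr.
have d1E w f : (\sum_e w e * d1 e f = \sum_i ext w (edge (val f) i))%R.
  under eq_bigr => e _ do rewrite mulr_sumr.
  rewrite exchange_big; apply: eq_bigr => i _ /=.
  by apply: sum_ext; apply: edge_in_all; apply: valP.
apply: (@exact_cochain_card _ _ _ _ d0 d1).
- case: {PK} P P0 d0 d1 d0E d1E Ps => // f P' *; apply/card_gt0P.
  have fP : f 0%R \in verts (f :: P') by apply: mem_verts; rewrite mem_head.
  by exists (SeqSub fP).
- move=> e; have := d0E (fun=> 1%R) e.
  have [e1 e2] := all_edges_verts (valP e).
  rewrite !(ext_restrict (fun=> 1%R)) // F2_addxx => d0e.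
  by rewrite -[RHS]d0e; apply: eq_bigr => v _; rewrite mul1r.
(* A 0-cocycle agrees at the two ends of each edge, hence along paths, so it is constant. *)
- move=> u u0; have u_adj a b : adj P a b -> ext u a = ext u b.
    move/adjP => abP; apply: F2_add0; rewrite -nedge_sum.
    by rewrite -(d0E u (SeqSub abP)).
  have u_path x s : epath P x s -> ext u x = ext u (last x s).
    by elim: s x => //= y s IHs x [/u_adj-> /IHs].
  case: Ps => Pc _.
  case: (pickP (fun _ : seq_sub (verts P) => true)) => [v0 _ | none]; last first.
    by exists 0%R => v; have := none v.
  exists (u v0) => v; have [s [ps ls]] := Pc _ _ (valP v0) (valP v).
  by rewrite -!ext_val -ls (u_path _ _ ps).
- move=> v f; rewrite d1E.
  transitivity (\sum_i ((val v == val f i)%:R + (val v == val f (i + 1)%R)%:R) : F2)%R.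
    apply: eq_bigr => i _; rewrite -(nedge_sum (fun x => (val v == x)%:R)%R).
    exact: (ext_restrict (fun e => (val v == e.1)%:R + (val v == e.2)%:R)%R
      (edge_in_all i (valP f))).
  rewrite big_split /=.
  (* Around the face, the starts and the ends of the edges are the same corners shifted by 1, so
     each corner counts twice. *)
  by rewrite [X in (X + _)%R](reindex_inj (addIr (1 : 'I_5)%R)) F2_addxx.
- move=> w w0; have [u uP] : exists u : nat -> F2,
      forall a b, adj P a b -> (ext w (nedge a b) = u a + u b)%R.
    by apply: cocycle_potential => // f fP; rewrite -(d1E w (SeqSub fP)).
  exists (fun v => u (val v)) => e; rewrite d0E.
  have [e1 e2] := all_edges_verts (valP e); rewrite !ext_restrict //.
  have /mem_all_edges[f fP [i ef]] := valP e.
  rewrite -ext_val ef nedge_sum; apply: uP.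
  by apply/adjP; rewrite edge_in_all.
- move=> t; have [W WP] := coboundary_onto (ext t) PK.
  exists (fun e => W (val e)) => f.
  rewrite d1E -(ext_val t f) -(WP _ (valP f)); apply: eq_bigr => i _.
  exact: (ext_restrict W (edge_in_all i (valP f))).
Qed.

(** * Automorphisms *)

Section Automorphism.
Variables (n : nat) (P : seq face).
Hypothesis PK : patch_of n P.

Lemma patch_corner : {in P &, forall (f g : face) j, f j = g j -> f = g}.
Proof.
move=> f g /(allP PK) fK /(allP PK) gK; exact: (good_corner (Kn_good n) fK gK).
Qed.

(** A label does not differ from itself by 2 mod 5, so [good_edge] leaves [f = g]; the crossing then
    equates two consecutive corners of one face. This rules out flips of an edge. *)
Lemma patch_edge : {in P &, forall (f g : face) i, f i = g (i + 1)%R ->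
  f (i + 1)%R <> g i}.
Proof.
move=> f g /(allP PK) fK /(allP PK) gK i e1 e2; have gd := Kn_good n.
have ee : edge f i = edge g i by rewrite /edge e1 e2 nedgeC.
case: (good_edge gd fK gK ee) => [[fg _]|[]].
- move: e1; rewrite fg => /(good_inj gd gK) /eqP.
  by rewrite eq_sym -subr_eq0 addrAC subrr.
- by move=> /eqP; rewrite eq_sym -subr_eq0 addrAC subrr.
- by move=> /eqP; rewrite eq_sym -subr_eq0 addrAC subrr.
Qed.

Lemma automorphism_iter phi psi k : automorphism P phi psi ->
  automorphism P (iter k phi) (iter k psi).
Proof.
move=> [phi_inj [phi_in [phi_onto [psi_inj [psi_in [psi_onto psiE]]]]]].
have iphi j : {in verts P, forall v, iter j phi v \in verts P}.
  by move=> v vP; elim: j => //= j; apply: phi_in.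
have ipsi j : {in P, forall f, iter j psi f \in P}.
  by move=> f fP; elim: j => //= j; apply: psi_in.
split; [|split; [|split; [|split; [|split; [|split]]]]] => //.
- elim: k => // k IHk x y xP yP /= /phi_inj eq_k; apply: IHk => //.
  by apply: eq_k; apply: iphi.
- elim: k => [|k IHk] v vP; first by exists v.
  have [w wP <-] := phi_onto _ vP; have [x xP <-] := IHk _ wP.
  by exists x.
- elim: k => // k IHk x y xP yP /= /psi_inj eq_k; apply: IHk => //.
  by apply: eq_k; apply: ipsi.
- elim: k => [|k IHk] v vP; first by exists v.
  have [w wP <-] := psi_onto _ vP; have [x xP <-] := IHk _ wP.
  by exists x.
- by elim: k => // k IHk f fP j /=; rewrite psiE ?ipsi // IHk.
Qed.

Section Free.
Variables (phi : nat -> nat) (psi : face -> face).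
Hypothesis aut : automorphism P phi psi.
Hypothesis Pc : chain_connected P.

Let psi_in : {in P, forall f, psi f \in P}.
Proof. by case: aut => _ [_ [_ [_ []]]]. Qed.
Let psiE : {in P, forall f (j : 'I_5), psi f j = phi (f j)}.
Proof. by case: aut => _ [_ [_ [_ [_ []]]]]. Qed.

Lemma aut_face_fixed f j : f \in P -> phi (f j) = f j -> psi f = f.
Proof.
by move=> fP fj; apply: (@patch_corner _ _ _ _ j); rewrite ?psi_in ?psiE.
Qed.

Lemma chain_mem f g : chain P f g -> g \in P.
Proof. by case. Qed.

(** A fixed corner fixes its face, hence all corners of that face; the next face of a chain shares
    an edge with it, and so a vertex. *)
Lemma aut_rigid v : v \in verts P -> phi v = v -> {in verts P, forall w, phi w = w}.
Proof.
case/vertsP=> f fP [j ->] /(aut_face_fixed fP) ff w /vertsP[g gP [i ->]].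
suff gg : psi g = g by rewrite -psiE ?gg.
have fg := Pc fP gP; elim: fg ff {fP gP} => // {}f {}g h fg IH hP [k [l e_gh]] /IH gg.
have gfix m : phi (g m) = g m by rewrite -psiE ?gg //; apply: chain_mem fg.
have [e|e] : g k = h l \/ g k = h (l + 1)%R by case/nedge_eq: e_gh => -[]; auto.
  by apply: (@aut_face_fixed _ l) => //; rewrite -e.
by apply: (@aut_face_fixed _ (l + 1)%R) => //; rewrite -e.
Qed.

(** [psi f] carries the same edge at the same label as [f]; [patch_edge] excludes the reversal, so
    an end is fixed. *)
Lemma aut_edge_fixed e : e \in all_edges P ->
  nedge (phi e.1) (phi e.2) = e -> exists2 v, v \in verts P & phi v = v.
Proof.
case/mem_all_edges=> f fP [i ->].
rewrite nedge_map -!psiE // => /nedge_eq[[fi _]|[e1 e2]].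
  by exists (f i); rewrite ?mem_verts // -psiE.
by case: (patch_edge (psi_in fP) fP e1 e2).
Qed.

End Free.

Lemma seq_sub_prime_dvd (T : choiceType) (s : seq T) (p : nat) (g : T -> T) :
    prime p -> {in s, forall x, g x \in s} -> {in s, forall x, iter p g x = x} ->
  {in s, forall x, g x <> x} -> p %| #|{: seq_sub s}|.
Proof.
move=> p_pr g_in gp g_free.
(* The default of [insubd] is never taken, since [g] maps [s] to itself. *)
pose h (x : seq_sub s) := insubd x (g (val x)).
have hE x : val (h x) = g (val x) by rewrite val_insubd (g_in _ (valP x)).
have hk k x : val (iter k h x) = iter k g (val x).
  by elim: k => // k IHk; rewrite iterS hE IHk.
apply: (@fpfree_prime_dvd _ _ h) => // x.
  by apply: val_inj; rewrite hk (gp _ (valP x)).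
by move/(congr1 val); rewrite hE; apply: g_free; apply: valP.
Qed.

(** Were a vertex moved, [aut_rigid] would exclude fixed vertices, and then no face or edge is fixed
    either; [p] divides the three counts of [euler_patch], hence divides 1. *)
Lemma aut_prime_order phi psi p : simply_connected P -> chain_connected P ->
  automorphism P phi psi -> prime p -> {in verts P, forall v, iter p phi v = v} ->
  {in verts P, forall v, phi v = v}.
Proof.
move=> Ps Pc aut p_pr phi_p v vP; apply/eqP/negPn/negP => /eqP v_moved.
have free w : w \in verts P -> phi w <> w.
  by move=> wP /(aut_rigid aut Pc wP)/(_ _ vP).
have [phi_inj [phi_in [_ [_ [psi_in [_ psiE]]]]]] := aut.
have ipsi_in k : {in P, forall f, iter k psi f \in P}.
  by have [_ [_ [_ [_ []]]]] := automorphism_iter k aut.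
have psi_p : {in P, forall f, iter p psi f = f}.
  move=> f fP; have [_ [_ [_ [_ [_ [_ ipsiE]]]]]] := automorphism_iter p aut.
  by apply/ffunP => j; rewrite ipsiE // phi_p // mem_verts.
pose phiE e := nedge (phi e.1) (phi e.2).
have phiEE f i : f \in P -> phiE (edge f i) = edge (psi f) i.
  by move=> fP; rewrite /phiE nedge_map /edge !psiE.
have dvdV : p %| #|{: seq_sub (verts P)}| by apply: (@seq_sub_prime_dvd _ _ _ phi).
have dvdF : p %| #|{: seq_sub P}|.
  apply: (@seq_sub_prime_dvd _ _ _ psi) => // f fP ff.
  have /free[] : f 0%R \in verts P by apply: mem_verts.
  by rewrite -psiE ?ff.
have dvdE : p %| #|{: seq_sub (all_edges P)}|.
  apply: (@seq_sub_prime_dvd _ _ _ phiE) => // e.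
  - by case/mem_all_edges=> f fP [i ->]; rewrite phiEE ?edge_in_all // psi_in.
  - case/mem_all_edges=> f fP [i ->].
    have -> k : iter k phiE (edge f i) = edge (iter k psi f) i.
      by elim: k => //= k ->; rewrite phiEE ?ipsi_in.
    by rewrite psi_p.
  - by move=> eP /(aut_edge_fixed aut eP)[w wP]; apply: free.
have P0 : P <> [::] by move=> P0; move: vP; rewrite P0.
have euler := euler_patch PK Ps P0.
have: p %| #|{: seq_sub (all_edges P)}| + 1.
  by rewrite -euler dvdn_add.
by rewrite dvdn_addr // Euclid_dvd1.
Qed.

(** On the vertices, [phi] is a permutation [s]. If it is nontrivial, its order has a prime divisor
    [p]; the iterate of [phi] by the order over [p] falls under [aut_prime_order], against the
    minimality of the order. *)
Lemma automorphism_id phi psi : simply_connected P -> chain_connected P ->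
  automorphism P phi psi -> {in verts P, forall v, phi v = v}.
Proof.
move=> Ps Pc aut v vP; apply/eqP/negPn/negP => /eqP v_moved.
have [phi_inj [phi_in _]] := aut.
pose h (x : seq_sub (verts P)) := insubd x (phi (val x)).
have hE x : val (h x) = phi (val x) by rewrite val_insubd (phi_in _ (valP x)).
have h_inj : injective h.
  move=> x y /(congr1 val); rewrite !hE => /phi_inj eq_xy.
  by apply: val_inj; apply: eq_xy; apply: valP.
pose s := perm h_inj.
have sE k x : val ((s ^+ k)%g x) = iter k phi (val x).
  by rewrite permX; elim: k => // k IHk; rewrite iterS permE hE IHk.
have s_gt1 : 1 < #[s]%g.
  rewrite ltn_neqAle order_gt0 andbT eq_sym order_eq1; apply/eqP => s1.
  by apply: v_moved; have := sE 1 (SeqSub vP); rewrite s1 expg1n perm1.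
pose p := pdiv #[s]%g; have p_pr : prime p by apply: pdiv_prime.
pose k := #[s]%g %/ p.
have pk : k * p = #[s]%g by rewrite divnK // pdiv_dvd.
have phi_k : {in verts P, forall w, iter k phi w = w}.
  apply: (@aut_prime_order _ (iter k psi) p) => //; first exact: automorphism_iter.
  move=> w wP; have := sE (k * p) (SeqSub wP); rewrite pk expg_order perm1 /=.
  by rewrite -pk mulnC => {2}->; elim: (p) => //= q ->; rewrite iterD.
have : (s ^+ k = 1)%g.
  by apply/permP => x; apply: val_inj; rewrite sE perm1 (phi_k _ (valP x)).
move/eqP; rewrite -order_dvdn => /dvdn_leq.
have k_gt0 : 0 < k by rewrite divn_gt0 ?pdiv_gt0 // pdiv_leq // ltnW.
move=> /(_ k_gt0); rewrite leqNgt -pk.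
by rewrite -[X in X < _]muln1 ltn_pmul2l // prime_gt1.
Qed.

End Automorphism.

Theorem theoremt (n : nat) (P : seq face) (phi : nat -> nat) (psi : face -> face) :
  patch_of n P -> simply_connected P -> chain_connected P ->
  automorphism P phi psi ->
  {in verts P, forall v, phi v = v} /\ {in P, forall f, psi f = f}.
Proof.
move=> PK Ps Pc aut; have phi_id := automorphism_id PK Ps Pc aut.
(* A face is the function of its corners, so fixed vertices force fixed faces. *)
split=> // f fP; apply/ffunP => j.
by have [_ [_ [_ [_ [_ [_ psiE]]]]]] := aut; rewrite psiE // phi_id // mem_verts.
Qed.
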